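(* Let $p:\mathbb{E}\to\mathbb{B}$ be a fibred type-theoretic fibration category and $R:\mathbb{T}(M)\to\mathbb{E}$ a logical predicate on an interpretation $F:\mathbb{T}(M)\to\mathbb{B}$ of a Martin-Löf type theory $M$ in $\mathbb{B}$. Then for any term $a:A\vdash t(a):B(a)$ of $M$, there exists a term $$a:FA\mid r:RA(a)\vdash\hat t(a;r):RB(a,Ft(a);r)$$ in the internal language for $p$, where $\hat t$ is the morphism $RA\to(Ft)^*RB$ induced from $Rt:RA\to RB$.
   Context: A type-theoretic fibration category is a category $\mathbb{C}$ with a terminal object $1$ and a subcategory whose morphisms are called fibrations, such that (an acyclic cofibration being a morphism with the left lifting property with respect to all fibrations): (i) all isomorphisms and all morphisms with codomain $1$ are fibrations; (ii) pullbacks of fibrations along arbitrary morphisms exist and are fibrations; (iii) every morphism factors as an acyclic cofibration followed by a fibration; (iv) for any fibrations $f:A\to B$ and $g:B\to C$ there is a fibration $\Pi_gf:\Pi_gA\to C$, called a dependent product of $f$ along $g$, with a natural bijection $(\mathbb{C}/C)(h,\Pi_gf)\cong(\mathbb{C}/B)(g^*h,f)$ for all $h:X\to C$. A type-theoretic functor preserves terminal objects, fibrations, pullbacks of fibrations, acyclic cofibrations and dependent products. A fibred category is a Grothendieck fibration; $\mathbb{E}_I$ is the fiber over $I$, and $f$ is above $s$ if $pf=s$. A fibred type-theoretic fibration category is a fibred category $p:\mathbb{E}\to\mathbb{B}$ such that: (1) $\mathbb{E}$ and $\mathbb{B}$ are type-theoretic fibration categories and $p$ is a type-theoretic functor; (2)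 every cartesian morphism above a fibration is a fibration; (3) if $g:A\to C$ is a fibration in $\mathbb{E}$, $pg=t\circ s$ with $s:pA\to J$ a fibration and $t:J\to pC$, then the induced morphism $A\to t^*C$ above $s$ is a fibration; (4) every cartesian morphism above an acyclic cofibration is an acyclic cofibration. Each fiber $\mathbb{E}_I$ is then a type-theoretic fibration category whose fibrations are the morphisms of $\mathbb{E}_I$ that are fibrations in $\mathbb{E}$. $M$ is a Martin-Löf type theory with dependent products, dependent sums and identity types, and $\mathbb{T}(M)$ is its syntactic category, a type-theoretic fibration category in which a type $a:A\vdash B(a)$ over $A$ gives a fibration $\pi_B:B\to A$ (writing $B$ also for the extended context) and a term $a:A\vdash t(a):B(a)$ gives a section $t:A\to B$ of $\pi_B$. An interpretation of $M$ in $\mathbb{C}$ is a type-theoretic functor $\mathbb{T}(M)\to\mathbb{C}$. A logical predicate on an interpretation $F:\mathbb{T}(M)\to\mathbb{B}$ with respect to $p$ is an interpretation $R:\mathbb{T}(M)\to\mathbb{E}$ with $p\circ R=F$. Internal language of $p$: kinds and their terms are types and terms of the internal language of $\mathbb{B}$ (types over $\Gamma$ are fibrations into $\Gamma$, terms are sections); types and terms over a kind $\Gamma$, in judgments $\gamma:\Gamma\mid a:A(\gamma)\vdash B(\gamma;a)\ \mathsf{type}$ and $\gamma:\Gamma\mid a:A(\gamma)\vdash b(\gamma;a):B(\gamma;a)$, are those of the internal language of $\mathbb{E}_\Gamma$ (fibrations in $\mathbb{E}_\Gamma$ into $A$, and their sections). Substitution of kind terms is reindexing. Here $RA$ is viewed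 as the type $a:FA\mid()\vdash RA(a)$; the fibration $R\pi_B:RB\to RA$ above $F\pi_B$ gives the type $a:FA,b:FB(a)\mid r:RA(a)\vdash RB(a,b;r)$, i.e. the induced fibration $RB\to(F\pi_B)^*RA$ in $\mathbb{E}_{FB}$. Its reindexing along the section $Ft:FA\to FB$ is a fibration $(Ft)^*RB\to(Ft)^*(F\pi_B)^*RA\cong RA$ in $\mathbb{E}_{FA}$, denoted by the type $a:FA\mid r:RA(a)\vdash RB(a,Ft(a);r)$, and a term of that type is a section of this fibration in $\mathbb{E}_{FA}$. *)

(* Defs.v *)
From Stdlib Require Import List ProofIrrelevance FunctionalExtensionality
  PropExtensionality Eqdep.
Import ListNotations.

Set Implicit Arguments.
Unset Strict Implicit.
Unset Printing Implicit Defensive.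

(* Plain Rocq with the Stdlib: categories have Leibniz equality on morphisms. *)

(** * Categories and functors *)

Declare Scope cat_scope.
Delimit Scope cat_scope with cat.
Local Open Scope cat_scope.

Record category := Category {
  ob :> Type;
  hom : ob -> ob -> Type;
  idm : forall X, hom X X;
  comp : forall X Y Z, hom Y Z -> hom X Y -> hom X Z;
  comp_idl : forall X Y (f : hom X Y), comp (idm Y) f = f;
  comp_idr : forall X Y (f : hom X Y), comp f (idm X) = f;
  comp_assoc : forall W X Y Z (h : hom Y Z) (g : hom X Y) (f : hom W X),
    comp h (comp g f) = comp (comp h g) f
}.

Arguments hom {c} X Y : rename.
Arguments idm {c} X : rename.
Arguments comp {c X Y Z} g f : rename.

Notation "g ∘ f" := (comp g f) (at level 40, left associativity) : cat_scope.

Definition is_iso {C : category} {X Y : C} (f : hom X Y) : Prop :=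
  exists g : hom Y X, g ∘ f = idm X /\ f ∘ g = idm Y.

Definition is_terminal {C : category} (T : C) : Prop :=
  forall X : C, exists! f : hom X T, True.

Definition is_pullback {C : category} {X Y Z P : C}
    (f : hom X Z) (g : hom Y Z) (p1 : hom P X) (p2 : hom P Y) : Prop :=
  f ∘ p1 = g ∘ p2 /\
  forall (W : C) (a : hom W X) (b : hom W Y), f ∘ a = g ∘ b ->
    exists! u : hom W P, p1 ∘ u = a /\ p2 ∘ u = b.

(* Morphisms of the slice category over Z. *)
Definition slice_hom {C : category} {X Y Z : C} (h : hom X Z) (k : hom Y Z) :=
  {u : hom X Y | k ∘ u = h}.

Lemma slice_comp_proof (C : category) (X1 X2 X3 Z : C)
    (h1 : hom X1 Z) (h2 : hom X2 Z) (h3 : hom X3 Z)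
    (v : slice_hom h2 h3) (u : slice_hom h1 h2) :
  h3 ∘ (proj1_sig v ∘ proj1_sig u) = h1.
Proof.
  destruct u as [u <-], v as [v <-]; simpl. now rewrite !comp_assoc.
Qed.

Definition slice_comp {C : category} {X1 X2 X3 Z : C}
    {h1 : hom X1 Z} {h2 : hom X2 Z} {h3 : hom X3 Z}
    (v : slice_hom h2 h3) (u : slice_hom h1 h2) : slice_hom h1 h3 :=
  exist _ (proj1_sig v ∘ proj1_sig u) (slice_comp_proof v u).

Record functor (C D : category) := Functor {
  fobj :> C -> D;
  fmap : forall X Y : C, hom X Y -> hom (fobj X) (fobj Y);
  fmap_id : forall X, fmap (idm X) = idm (fobj X);
  fmap_comp : forall X Y Z (g : hom Y Z) (f : hom X Y),
    fmap (g ∘ f) = fmap g ∘ fmap f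
}.

Arguments fmap {C D} F {X Y} f : rename.

Lemma functor_comp_id (C D E : category) (G : functor D E) (F : functor C D)
    (X : C) : fmap G (fmap F (idm X)) = idm (G (F X)).
Proof. now rewrite !fmap_id. Qed.

Lemma functor_comp_comp (C D E : category) (G : functor D E) (F : functor C D)
    (X Y Z : C) (g : hom Y Z) (f : hom X Y) :
  fmap G (fmap F (g ∘ f)) = fmap G (fmap F g) ∘ fmap G (fmap F f).
Proof. now rewrite !fmap_comp. Qed.

Definition functor_comp {C D E : category}
    (G : functor D E) (F : functor C D) : functor C E :=
  @Functor C E (fun X => G (F X)) (fun X Y f => fmap G (fmap F f))
    (functor_comp_id G F) (@functor_comp_comp C D E G F).

Definition fmap_slice {C D : category} (F : functor C D) {X Y Z : C}
    {h : hom X Z} {k : hom Y Z} (u : slice_hom h k) :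
    slice_hom (fmap F h) (fmap F k) :=
  exist _ (fmap F (proj1_sig u))
    (eq_trans (eq_sym (fmap_comp F k (proj1_sig u)))
              (f_equal (fmap F) (proj2_sig u))).

(** * Type-theoretic fibration categories *)

(* The axioms on the distinguished morphisms are in [is_ttfc]. *)
Record fib_category := FibCategory {
  underlying :> category;
  fib : forall X Y : underlying, hom X Y -> Prop
}.

Arguments fib {f X Y} _ : rename.

Definition acyclic_cofib {C : fib_category} {A B : C} (i : hom A B) : Prop :=
  forall (X Y : C) (q : hom X Y), fib q ->
  forall (a : hom A X) (b : hom B Y), q ∘ a = b ∘ i ->
  exists d : hom B X, d ∘ i = a /\ q ∘ d = b.

(* A bijection (C/Z)(h, π) ≅ (C/Y)(g^*h, f), natural in h : W -> Z.  The
   pullback g^*h = q2 ranges over all pullbacks of h along g, and a morphism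
   g^*h' -> g^*h lies over u : h' -> h when it commutes with the projections
   to W' and W. *)
Record dependent_product {C : category} {X Y Z P : C}
    (f : hom X Y) (g : hom Y Z) (π : hom P Z) := DependentProduct {
  transpose : forall (W Q : C) (h : hom W Z) (q1 : hom Q W) (q2 : hom Q Y),
    is_pullback h g q1 q2 -> slice_hom h π -> slice_hom q2 f;
  transpose_bij : forall (W Q : C) (h : hom W Z) (q1 : hom Q W) (q2 : hom Q Y)
    (pb : is_pullback h g q1 q2) (m : slice_hom q2 f),
    exists! k : slice_hom h π, transpose pb k = m;
  transpose_nat : forall (W Q W' Q' : C)
    (h : hom W Z) (q1 : hom Q W) (q2 : hom Q Y)
    (h' : hom W' Z) (q1' : hom Q' W') (q2' : hom Q' Y)
    (pb : is_pullback h g q1 q2) (pb' : is_pullback h' g q1' q2')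
    (u : slice_hom h' h) (w : slice_hom q2' q2),
    q1 ∘ proj1_sig w = proj1_sig u ∘ q1' ->
    forall k : slice_hom h π,
      transpose pb' (slice_comp k u) = slice_comp (transpose pb k) w
}.

Arguments transpose {C X Y Z P f g π} d {W Q h q1 q2} pb k : rename.

Record is_ttfc (C : fib_category) : Prop := IsTTFC {
  ttfc_terminal : exists T : C, is_terminal T;
  fib_comp : forall (X Y Z : C) (g : hom Y Z) (f : hom X Y),
    fib g -> fib f -> fib (g ∘ f);
  fib_iso : forall (X Y : C) (f : hom X Y), is_iso f -> fib f;
  fib_terminal : forall (X T : C) (f : hom X T), is_terminal T -> fib f;
  pullback_exists : forall (X Y Z : C) (f : hom X Z) (g : hom Y Z), fib f ->
    exists (P : C) (p1 : hom P X) (p2 : hom P Y), is_pullback f g p1 p2;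
  pullback_fib : forall (X Y Z P : C) (f : hom X Z) (g : hom Y Z)
    (p1 : hom P X) (p2 : hom P Y), fib f -> is_pullback f g p1 p2 -> fib p2;
  factorization : forall (X Z : C) (f : hom X Z),
    exists (Y : C) (i : hom X Y) (q : hom Y Z),
      acyclic_cofib i /\ fib q /\ f = q ∘ i;
  dependent_product_exists : forall (X Y Z : C) (f : hom X Y) (g : hom Y Z),
    fib f -> fib g -> exists (P : C) (π : hom P Z),
      fib π /\ inhabited (dependent_product f g π)
}.

(* The last clause says that F sends a dependent product of f along g to one of
   F f along F g, the bijections being compatible with the action of F. *)
Record type_theoretic {C D : fib_category} (F : functor C D) : Prop :=
  TypeTheoretic {
  tt_terminal : forall T : C, is_terminal T -> is_terminal (F T);
  tt_fib : forall (X Y : C) (f : hom X Y), fib f -> fib (fmap F f);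
  tt_pullback : forall (X Y Z P : C) (f : hom X Z) (g : hom Y Z)
    (p1 : hom P X) (p2 : hom P Y), fib f -> is_pullback f g p1 p2 ->
    is_pullback (fmap F f) (fmap F g) (fmap F p1) (fmap F p2);
  tt_acyclic_cofib : forall (X Y : C) (i : hom X Y),
    acyclic_cofib i -> acyclic_cofib (fmap F i);
  tt_dependent_product : forall (X Y Z P : C)
    (f : hom X Y) (g : hom Y Z) (π : hom P Z) (Φ : dependent_product f g π),
    fib f -> fib g -> fib π ->
    exists Φ' : dependent_product (fmap F f) (fmap F g) (fmap F π),
    forall (W Q : C) (h : hom W Z) (q1 : hom Q W) (q2 : hom Q Y)
      (pb : is_pullback h g q1 q2)
      (pb' : is_pullback (fmap F h) (fmap F g) (fmap F q1) (fmap F q2))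
      (k : slice_hom h π),
      transpose Φ' pb' (fmap_slice F k) = fmap_slice F (transpose Φ pb k)
}.

(** * Fibred categories *)

(* Equality of morphisms whose endpoints need only be propositionally equal. *)
Inductive hom_eq {C : category} {X Y : C} (f : hom X Y) :
    forall X' Y' : C, hom X' Y' -> Prop :=
  hom_eq_refl : hom_eq f f.

Lemma hom_eq_eq (C : category) (X Y : C) (f g : hom X Y) :
  hom_eq f g -> f = g.
Proof.
  intro H.
  assert (E : existT (fun X => {Y & hom X Y}) X (existT _ Y f)
            = existT (fun X => {Y & hom X Y}) X (existT _ Y g))
    by (destruct H; reflexivity).
  apply (inj_pair2 _ _ _ _ _ (inj_pair2 _ _ _ _ _ E)).
Qed.

Lemma hom_eq_comp (C : category) (X Y Z X' Y' Z' : C)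
    (g : hom Y Z) (f : hom X Y) (g' : hom Y' Z') (f' : hom X' Y') :
  hom_eq f f' -> hom_eq g g' -> hom_eq (g ∘ f) (g' ∘ f').
Proof.
  intros Hf Hg.
  assert (EX : X = X') by now destruct Hf.
  assert (EY : Y = Y') by now destruct Hf.
  assert (EZ : Z = Z') by now destruct Hg.
  subst. apply hom_eq_eq in Hf. apply hom_eq_eq in Hg. subst. constructor.
Qed.

(* p f = s *)
Definition above {E B : category} (p : functor E B) {X Y : E} (f : hom X Y)
    {I J : B} (s : hom I J) : Prop :=
  hom_eq (fmap p f) s.

Definition cartesian {E B : category} (p : functor E B) {X Y : E}
    (f : hom X Y) : Prop :=
  forall (Z : E) (g : hom Z Y) (w : hom (p Z) (p X)),
    fmap p g = fmap p f ∘ w -> exists! h : hom Z X, fmap p h = w /\ f ∘ h = g.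

Definition grothendieck_fibration {E B : category} (p : functor E B) : Prop :=
  forall (Y : E) (I : B) (s : hom I (p Y)),
    exists (X : E) (f : hom X Y), above p f s /\ cartesian p f.

Record fibred_ttfc {E B : fib_category} (p : functor E B) : Prop := FibredTTFC {
  fibred_grothendieck : grothendieck_fibration p;
  fibred_total : is_ttfc E;
  fibred_base : is_ttfc B;
  fibred_type_theoretic : type_theoretic p;
  fibred_cartesian_fib : forall (X Y : E) (f : hom X Y),
    cartesian p f -> fib (fmap p f) -> fib f;
  fibred_induced_fib : forall (A C : E) (g : hom A C) (J : B)
    (s : hom (p A) J) (t : hom J (p C)),
    fib g -> fmap p g = t ∘ s -> fib s ->
    forall (D : E) (k : hom D C), above p k t -> cartesian p k ->
    forall h : hom A D, above p h s -> k ∘ h = g -> fib h;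
  fibred_cartesian_acyclic_cofib : forall (X Y : E) (f : hom X Y),
    cartesian p f -> acyclic_cofib (fmap p f) -> acyclic_cofib f
}.

(** * Fibers and reindexing *)

Section Fiber.
Context {E B : category} (p : functor E B) (I : B).

Definition fiber_ob := {X : E | p X = I}.

Definition fiber_hom (X Y : fiber_ob) :=
  {f : hom (proj1_sig X) (proj1_sig Y) | above p f (idm I)}.

Lemma fiber_hom_eq (X Y : fiber_ob) (f g : fiber_hom X Y) :
  proj1_sig f = proj1_sig g -> f = g.
Proof.
  destruct f as [f Hf], g as [g Hg]; simpl; intros ->.
  f_equal. apply proof_irrelevance.
Qed.

Lemma fiber_id_proof (X : fiber_ob) : above p (idm (proj1_sig X)) (idm I).
Proof.
  destruct X as [X e]; simpl. unfold above. rewrite fmap_id.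
  destruct e. constructor.
Qed.

Lemma fiber_comp_proof (X Y Z : fiber_ob)
    (g : fiber_hom Y Z) (f : fiber_hom X Y) :
  above p (proj1_sig g ∘ proj1_sig f) (idm I).
Proof.
  unfold above. rewrite fmap_comp, <- (comp_idl (idm I)).
  exact (hom_eq_comp (proj2_sig f) (proj2_sig g)).
Qed.

Definition fiber_cat : category.
Proof.
  refine (@Category fiber_ob fiber_hom
    (fun X => exist _ (idm (proj1_sig X)) (fiber_id_proof X))
    (fun X Y Z g f =>
       exist _ (proj1_sig g ∘ proj1_sig f) (fiber_comp_proof g f)) _ _ _);
  intros; apply fiber_hom_eq; simpl.
  - apply comp_idl.
  - apply comp_idr.
  - apply comp_assoc.
Defined.
End Fiber.

Definition fiber {E B : fib_category} (p : functor E B) (I : B) : fib_category :=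
  @FibCategory (fiber_cat p I) (fun X Y f => fib (proj1_sig f)).

(* A choice of the reindexing s^*Y, with its cartesian morphism to Y. *)
Record reindexing {E B : fib_category} (p : functor E B) {I J : B}
    (s : hom I J) (Y : fiber p J) := Reindexing {
  reindexing_ob :> fiber p I;
  lift : hom (proj1_sig reindexing_ob) (proj1_sig Y);
  lift_above : above p lift s;
  lift_cartesian : cartesian p lift
}.

Arguments lift {E B p I J s Y} _.

(* v is the reindexing s^*f : s^*X -> s^*Y of the morphism f of the fiber. *)
Definition is_reindexing_of {E B : fib_category} {p : functor E B} {I J : B}
    {s : hom I J} {X Y : fiber p J} (f : hom X Y)
    {QX : reindexing s X} {QY : reindexing s Y}
    (v : hom (QX : fiber p I) (QY : fiber p I)) : Prop :=
  lift QY ∘ proj1_sig v = proj1_sig f ∘ lift QX.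

(* A type in context A of the internal language of C is a fibration into A and
   its terms are the sections; types and terms of the internal language of p
   over a kind Γ are those of [fiber p Γ]. *)
Definition is_type {C : fib_category} {A T : C} (π : hom T A) : Prop := fib π.

Definition is_term {C : fib_category} {A T : C} (π : hom T A) (t : hom A T) :
    Prop :=
  π ∘ t = idm A.

(** * Martin-Löf type theories *)

(* Raw syntax with de Bruijn indices and explicit substitutions over a set of
   constants.  [v0] is the last variable, the others being [v0] weakened by
   [wk]; [tsub A σ] is A[σ]; [scomp τ σ] is τ ∘ σ.  [pi A B], [sigma A B],
   [lam b] bind one variable in B, b; in [J C d a b q], C binds three and d
   one. *)
Record symbols := Symbols { ty_cst : Type; tm_cst : Type }.

Inductive ty (S : symbols) : Type :=
| tcst (c : ty_cst S)
| tsub (A : ty S) (σ : sub S)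
| pi (A B : ty S)
| sigma (A B : ty S)
| ident (A : ty S) (a b : tm S)
with tm (S : symbols) : Type :=
| cst (c : tm_cst S)
| v0
| msub (a : tm S) (σ : sub S)
| lam (b : tm S)
| app (f a : tm S)
| tpair (a b : tm S)
| pr1 (c : tm S)
| pr2 (c : tm S)
| refl (a : tm S)
| J (C : ty S) (d a b q : tm S)
with sub (S : symbols) : Type :=
| sid
| scomp (τ σ : sub S)
| wk
| emp
| sext (σ : sub S) (a : tm S).

Arguments v0 {S}.
Arguments sid {S}.
Arguments wk {S}.
Arguments emp {S}.

(* The head of the list is the type of the last variable. *)
Definition ctx (S : symbols) := list (ty S).

Definition up {S : symbols} (σ : sub S) : sub S := sext (scomp σ wk) v0.

Definition inst {S : symbols} (a : tm S) : sub S := sext sid a.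

(* x : A, y : A, z : Id A x y *)
Definition J_ctx {S : symbols} (Γ : ctx S) (A : ty S) : ctx S :=
  ident (tsub (tsub A wk) wk) (msub v0 wk) v0 :: tsub A wk :: A :: Γ.

Definition J_inst {S : symbols} (a b q : tm S) : sub S :=
  sext (sext (inst a) b) q.

Definition J_diag {S : symbols} : sub S :=
  sext (sext (sext wk v0) v0) (refl v0).

(* The data specifying a type theory beyond its structural rules and its rules
   for dependent products, dependent sums and identity types: constants, each
   with a context (and a type, for a term constant), and equations. *)
Record theory := Theory {
  syms :> symbols;
  ty_cst_ctx : ty_cst syms -> ctx syms;
  tm_cst_ctx : tm_cst syms -> ctx syms;
  tm_cst_ty : tm_cst syms -> ty syms;
  ty_eqn : ctx syms -> ty syms -> ty syms -> Prop;
  tm_eqn : ctx syms -> tm syms -> tm syms -> ty syms -> Prop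
}.

Inductive judgment (S : symbols) : Type :=
| WfCtx (Γ : ctx S)
| EqCtx (Γ Γ' : ctx S)
| IsTy (Γ : ctx S) (A : ty S)
| EqTy (Γ : ctx S) (A A' : ty S)
| HasTy (Γ : ctx S) (a : tm S) (A : ty S)
| EqTm (Γ : ctx S) (a a' : tm S) (A : ty S)
| IsSub (Γ : ctx S) (σ : sub S) (Δ : ctx S)
| EqSub (Γ : ctx S) (σ σ' : sub S) (Δ : ctx S).

Reserved Notation "M ⊢ j" (at level 70, no associativity).

Inductive derivable (M : theory) : judgment M -> Prop :=

| wf_nil : M ⊢ WfCtx []
| wf_cons Γ A : M ⊢ WfCtx Γ -> M ⊢ IsTy Γ A -> M ⊢ WfCtx (A :: Γ)
| eqctx_nil : M ⊢ EqCtx [] []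
| eqctx_cons Γ Γ' A A' :
    M ⊢ EqCtx Γ Γ' -> M ⊢ IsTy Γ A -> M ⊢ IsTy Γ' A' -> M ⊢ EqTy Γ A A' ->
    M ⊢ EqCtx (A :: Γ) (A' :: Γ')

| isty_conv Γ Γ' A : M ⊢ EqCtx Γ Γ' -> M ⊢ IsTy Γ A -> M ⊢ IsTy Γ' A
| eqty_conv Γ Γ' A A' :
    M ⊢ EqCtx Γ Γ' -> M ⊢ EqTy Γ A A' -> M ⊢ EqTy Γ' A A'
| hasty_conv Γ Γ' a A A' :
    M ⊢ EqCtx Γ Γ' -> M ⊢ EqTy Γ A A' -> M ⊢ HasTy Γ a A -> M ⊢ HasTy Γ' a A'
| eqtm_conv Γ Γ' a a' A A' :
    M ⊢ EqCtx Γ Γ' -> M ⊢ EqTy Γ A A' -> M ⊢ EqTm Γ a a' A ->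
    M ⊢ EqTm Γ' a a' A'
| issub_conv Γ Γ' σ Δ Δ' :
    M ⊢ EqCtx Γ Γ' -> M ⊢ EqCtx Δ Δ' -> M ⊢ IsSub Γ σ Δ -> M ⊢ IsSub Γ' σ Δ'
| eqsub_conv Γ Γ' σ σ' Δ Δ' :
    M ⊢ EqCtx Γ Γ' -> M ⊢ EqCtx Δ Δ' -> M ⊢ EqSub Γ σ σ' Δ ->
    M ⊢ EqSub Γ' σ σ' Δ'

| eqty_refl Γ A : M ⊢ IsTy Γ A -> M ⊢ EqTy Γ A A
| eqty_sym Γ A A' : M ⊢ EqTy Γ A A' -> M ⊢ EqTy Γ A' A
| eqty_trans Γ A A' A'' :
    M ⊢ EqTy Γ A A' -> M ⊢ EqTy Γ A' A'' -> M ⊢ EqTy Γ A A''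
| eqtm_refl Γ a A : M ⊢ HasTy Γ a A -> M ⊢ EqTm Γ a a A
| eqtm_sym Γ a a' A : M ⊢ EqTm Γ a a' A -> M ⊢ EqTm Γ a' a A
| eqtm_trans Γ a a' a'' A :
    M ⊢ EqTm Γ a a' A -> M ⊢ EqTm Γ a' a'' A -> M ⊢ EqTm Γ a a'' A
| eqsub_refl Γ σ Δ : M ⊢ IsSub Γ σ Δ -> M ⊢ EqSub Γ σ σ Δ
| eqsub_sym Γ σ σ' Δ : M ⊢ EqSub Γ σ σ' Δ -> M ⊢ EqSub Γ σ' σ Δ
| eqsub_trans Γ σ σ' σ'' Δ :
    M ⊢ EqSub Γ σ σ' Δ -> M ⊢ EqSub Γ σ' σ'' Δ -> M ⊢ EqSub Γ σ σ'' Δ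

| issub_id Γ : M ⊢ WfCtx Γ -> M ⊢ IsSub Γ sid Γ
| issub_comp Γ Δ Θ σ τ :
    M ⊢ IsSub Γ σ Δ -> M ⊢ IsSub Δ τ Θ -> M ⊢ IsSub Γ (scomp τ σ) Θ
| issub_wk Γ A : M ⊢ WfCtx Γ -> M ⊢ IsTy Γ A -> M ⊢ IsSub (A :: Γ) wk Γ
| issub_emp Γ : M ⊢ WfCtx Γ -> M ⊢ IsSub Γ emp []
| issub_ext Γ Δ σ A a :
    M ⊢ IsSub Γ σ Δ -> M ⊢ IsTy Δ A -> M ⊢ HasTy Γ a (tsub A σ) ->
    M ⊢ IsSub Γ (sext σ a) (A :: Δ)
| eqsub_comp Γ Δ Θ σ σ' τ τ' :
    M ⊢ EqSub Γ σ σ' Δ -> M ⊢ EqSub Δ τ τ' Θ ->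
    M ⊢ EqSub Γ (scomp τ σ) (scomp τ' σ') Θ
| eqsub_ext Γ Δ σ σ' A a a' :
    M ⊢ EqSub Γ σ σ' Δ -> M ⊢ IsTy Δ A -> M ⊢ EqTm Γ a a' (tsub A σ) ->
    M ⊢ EqSub Γ (sext σ a) (sext σ' a') (A :: Δ)
| eqsub_idl Γ Δ σ : M ⊢ IsSub Γ σ Δ -> M ⊢ EqSub Γ (scomp sid σ) σ Δ
| eqsub_idr Γ Δ σ : M ⊢ IsSub Γ σ Δ -> M ⊢ EqSub Γ (scomp σ sid) σ Δ
| eqsub_assoc Γ Δ Θ Ξ σ τ ρ :
    M ⊢ IsSub Γ σ Δ -> M ⊢ IsSub Δ τ Θ -> M ⊢ IsSub Θ ρ Ξ ->
    M ⊢ EqSub Γ (scomp ρ (scomp τ σ)) (scomp (scomp ρ τ) σ) Ξ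
| eqsub_emp Γ σ : M ⊢ IsSub Γ σ [] -> M ⊢ EqSub Γ σ emp []
| eqsub_wk Γ Δ σ A a :
    M ⊢ IsSub Γ σ Δ -> M ⊢ IsTy Δ A -> M ⊢ HasTy Γ a (tsub A σ) ->
    M ⊢ EqSub Γ (scomp wk (sext σ a)) σ Δ
| eqsub_eta Γ Δ A σ :
    M ⊢ IsTy Δ A -> M ⊢ IsSub Γ σ (A :: Δ) ->
    M ⊢ EqSub Γ σ (sext (scomp wk σ) (msub v0 σ)) (A :: Δ)

| isty_sub Γ Δ σ A : M ⊢ IsSub Γ σ Δ -> M ⊢ IsTy Δ A -> M ⊢ IsTy Γ (tsub A σ)
| eqty_sub Γ Δ σ σ' A A' :
    M ⊢ EqSub Γ σ σ' Δ -> M ⊢ EqTy Δ A A' ->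
    M ⊢ EqTy Γ (tsub A σ) (tsub A' σ')
| eqty_sub_id Γ A : M ⊢ IsTy Γ A -> M ⊢ EqTy Γ (tsub A sid) A
| eqty_sub_comp Γ Δ Θ σ τ A :
    M ⊢ IsSub Γ σ Δ -> M ⊢ IsSub Δ τ Θ -> M ⊢ IsTy Θ A ->
    M ⊢ EqTy Γ (tsub A (scomp τ σ)) (tsub (tsub A τ) σ)
| hasty_var Γ A :
    M ⊢ WfCtx Γ -> M ⊢ IsTy Γ A -> M ⊢ HasTy (A :: Γ) v0 (tsub A wk)
| hasty_sub Γ Δ σ a A :
    M ⊢ IsSub Γ σ Δ -> M ⊢ HasTy Δ a A -> M ⊢ HasTy Γ (msub a σ) (tsub A σ)
| eqtm_sub Γ Δ σ σ' a a' A :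
    M ⊢ EqSub Γ σ σ' Δ -> M ⊢ EqTm Δ a a' A ->
    M ⊢ EqTm Γ (msub a σ) (msub a' σ') (tsub A σ)
| eqtm_sub_id Γ a A : M ⊢ HasTy Γ a A -> M ⊢ EqTm Γ (msub a sid) a A
| eqtm_sub_comp Γ Δ Θ σ τ a A :
    M ⊢ IsSub Γ σ Δ -> M ⊢ IsSub Δ τ Θ -> M ⊢ HasTy Θ a A ->
    M ⊢ EqTm Γ (msub a (scomp τ σ)) (msub (msub a τ) σ) (tsub A (scomp τ σ))
| eqtm_var Γ Δ σ A a :
    M ⊢ IsSub Γ σ Δ -> M ⊢ IsTy Δ A -> M ⊢ HasTy Γ a (tsub A σ) ->
    M ⊢ EqTm Γ (msub v0 (sext σ a)) a (tsub A σ)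

| isty_cst c : M ⊢ WfCtx (ty_cst_ctx c) -> M ⊢ IsTy (ty_cst_ctx c) (tcst c)
| hasty_cst c :
    M ⊢ WfCtx (tm_cst_ctx c) -> M ⊢ IsTy (tm_cst_ctx c) (tm_cst_ty c) ->
    M ⊢ HasTy (tm_cst_ctx c) (cst c) (tm_cst_ty c)
| eqty_eqn Γ A A' :
    M ⊢ WfCtx Γ -> M ⊢ IsTy Γ A -> M ⊢ IsTy Γ A' -> ty_eqn Γ A A' ->
    M ⊢ EqTy Γ A A'
| eqtm_eqn Γ a a' A :
    M ⊢ WfCtx Γ -> M ⊢ HasTy Γ a A -> M ⊢ HasTy Γ a' A -> tm_eqn Γ a a' A ->
    M ⊢ EqTm Γ a a' A

| isty_pi Γ A B : M ⊢ IsTy Γ A -> M ⊢ IsTy (A :: Γ) B -> M ⊢ IsTy Γ (pi A B)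
| eqty_pi Γ A A' B B' :
    M ⊢ IsTy Γ A -> M ⊢ EqTy Γ A A' -> M ⊢ EqTy (A :: Γ) B B' ->
    M ⊢ EqTy Γ (pi A B) (pi A' B')
| eqty_pi_sub Γ Δ σ A B :
    M ⊢ IsSub Γ σ Δ -> M ⊢ IsTy Δ A -> M ⊢ IsTy (A :: Δ) B ->
    M ⊢ EqTy Γ (tsub (pi A B) σ) (pi (tsub A σ) (tsub B (up σ)))
| hasty_lam Γ A B b :
    M ⊢ IsTy Γ A -> M ⊢ HasTy (A :: Γ) b B -> M ⊢ HasTy Γ (lam b) (pi A B)
| hasty_app Γ A B f a :
    M ⊢ IsTy Γ A -> M ⊢ IsTy (A :: Γ) B ->
    M ⊢ HasTy Γ f (pi A B) -> M ⊢ HasTy Γ a A ->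
    M ⊢ HasTy Γ (app f a) (tsub B (inst a))
| eqtm_lam Γ A B b b' :
    M ⊢ IsTy Γ A -> M ⊢ EqTm (A :: Γ) b b' B ->
    M ⊢ EqTm Γ (lam b) (lam b') (pi A B)
| eqtm_app Γ A B f f' a a' :
    M ⊢ IsTy Γ A -> M ⊢ IsTy (A :: Γ) B ->
    M ⊢ EqTm Γ f f' (pi A B) -> M ⊢ EqTm Γ a a' A ->
    M ⊢ EqTm Γ (app f a) (app f' a') (tsub B (inst a))
| eqtm_lam_sub Γ Δ σ A B b :
    M ⊢ IsSub Γ σ Δ -> M ⊢ IsTy Δ A -> M ⊢ HasTy (A :: Δ) b B ->
    M ⊢ EqTm Γ (msub (lam b) σ) (lam (msub b (up σ))) (tsub (pi A B) σ)
| eqtm_app_sub Γ Δ σ A B f a :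
    M ⊢ IsSub Γ σ Δ -> M ⊢ IsTy Δ A -> M ⊢ IsTy (A :: Δ) B ->
    M ⊢ HasTy Δ f (pi A B) -> M ⊢ HasTy Δ a A ->
    M ⊢ EqTm Γ (msub (app f a) σ) (app (msub f σ) (msub a σ))
               (tsub (tsub B (inst a)) σ)
| eqtm_pi_beta Γ A B b a :
    M ⊢ IsTy Γ A -> M ⊢ HasTy (A :: Γ) b B -> M ⊢ HasTy Γ a A ->
    M ⊢ EqTm Γ (app (lam b) a) (msub b (inst a)) (tsub B (inst a))
| eqtm_pi_eta Γ A B f :
    M ⊢ IsTy Γ A -> M ⊢ IsTy (A :: Γ) B -> M ⊢ HasTy Γ f (pi A B) ->
    M ⊢ EqTm Γ f (lam (app (msub f wk) v0)) (pi A B)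

| isty_sig Γ A B : M ⊢ IsTy Γ A -> M ⊢ IsTy (A :: Γ) B -> M ⊢ IsTy Γ (sigma A B)
| eqty_sig Γ A A' B B' :
    M ⊢ IsTy Γ A -> M ⊢ EqTy Γ A A' -> M ⊢ EqTy (A :: Γ) B B' ->
    M ⊢ EqTy Γ (sigma A B) (sigma A' B')
| eqty_sig_sub Γ Δ σ A B :
    M ⊢ IsSub Γ σ Δ -> M ⊢ IsTy Δ A -> M ⊢ IsTy (A :: Δ) B ->
    M ⊢ EqTy Γ (tsub (sigma A B) σ) (sigma (tsub A σ) (tsub B (up σ)))
| hasty_pair Γ A B a b :
    M ⊢ IsTy Γ A -> M ⊢ IsTy (A :: Γ) B ->
    M ⊢ HasTy Γ a A -> M ⊢ HasTy Γ b (tsub B (inst a)) ->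
    M ⊢ HasTy Γ (tpair a b) (sigma A B)
| hasty_fst Γ A B c :
    M ⊢ IsTy Γ A -> M ⊢ IsTy (A :: Γ) B -> M ⊢ HasTy Γ c (sigma A B) ->
    M ⊢ HasTy Γ (pr1 c) A
| hasty_snd Γ A B c :
    M ⊢ IsTy Γ A -> M ⊢ IsTy (A :: Γ) B -> M ⊢ HasTy Γ c (sigma A B) ->
    M ⊢ HasTy Γ (pr2 c) (tsub B (inst (pr1 c)))
| eqtm_pair Γ A B a a' b b' :
    M ⊢ IsTy Γ A -> M ⊢ IsTy (A :: Γ) B ->
    M ⊢ EqTm Γ a a' A -> M ⊢ EqTm Γ b b' (tsub B (inst a)) ->
    M ⊢ EqTm Γ (tpair a b) (tpair a' b') (sigma A B)
| eqtm_fst Γ A B c c' :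
    M ⊢ IsTy Γ A -> M ⊢ IsTy (A :: Γ) B -> M ⊢ EqTm Γ c c' (sigma A B) ->
    M ⊢ EqTm Γ (pr1 c) (pr1 c') A
| eqtm_snd Γ A B c c' :
    M ⊢ IsTy Γ A -> M ⊢ IsTy (A :: Γ) B -> M ⊢ EqTm Γ c c' (sigma A B) ->
    M ⊢ EqTm Γ (pr2 c) (pr2 c') (tsub B (inst (pr1 c)))
| eqtm_pair_sub Γ Δ σ A B a b :
    M ⊢ IsSub Γ σ Δ -> M ⊢ IsTy Δ A -> M ⊢ IsTy (A :: Δ) B ->
    M ⊢ HasTy Δ a A -> M ⊢ HasTy Δ b (tsub B (inst a)) ->
    M ⊢ EqTm Γ (msub (tpair a b) σ) (tpair (msub a σ) (msub b σ))
               (tsub (sigma A B) σ)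
| eqtm_fst_sub Γ Δ σ A B c :
    M ⊢ IsSub Γ σ Δ -> M ⊢ IsTy Δ A -> M ⊢ IsTy (A :: Δ) B ->
    M ⊢ HasTy Δ c (sigma A B) ->
    M ⊢ EqTm Γ (msub (pr1 c) σ) (pr1 (msub c σ)) (tsub A σ)
| eqtm_snd_sub Γ Δ σ A B c :
    M ⊢ IsSub Γ σ Δ -> M ⊢ IsTy Δ A -> M ⊢ IsTy (A :: Δ) B ->
    M ⊢ HasTy Δ c (sigma A B) ->
    M ⊢ EqTm Γ (msub (pr2 c) σ) (pr2 (msub c σ))
               (tsub (tsub B (inst (pr1 c))) σ)
| eqtm_fst_beta Γ A B a b :
    M ⊢ IsTy Γ A -> M ⊢ IsTy (A :: Γ) B ->
    M ⊢ HasTy Γ a A -> M ⊢ HasTy Γ b (tsub B (inst a)) ->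
    M ⊢ EqTm Γ (pr1 (tpair a b)) a A
| eqtm_snd_beta Γ A B a b :
    M ⊢ IsTy Γ A -> M ⊢ IsTy (A :: Γ) B ->
    M ⊢ HasTy Γ a A -> M ⊢ HasTy Γ b (tsub B (inst a)) ->
    M ⊢ EqTm Γ (pr2 (tpair a b)) b (tsub B (inst a))
| eqtm_sig_eta Γ A B c :
    M ⊢ IsTy Γ A -> M ⊢ IsTy (A :: Γ) B -> M ⊢ HasTy Γ c (sigma A B) ->
    M ⊢ EqTm Γ c (tpair (pr1 c) (pr2 c)) (sigma A B)

| isty_ident Γ A a b :
    M ⊢ IsTy Γ A -> M ⊢ HasTy Γ a A -> M ⊢ HasTy Γ b A ->
    M ⊢ IsTy Γ (ident A a b)
| eqty_ident Γ A A' a a' b b' :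
    M ⊢ EqTy Γ A A' -> M ⊢ EqTm Γ a a' A -> M ⊢ EqTm Γ b b' A ->
    M ⊢ EqTy Γ (ident A a b) (ident A' a' b')
| eqty_ident_sub Γ Δ σ A a b :
    M ⊢ IsSub Γ σ Δ -> M ⊢ IsTy Δ A -> M ⊢ HasTy Δ a A -> M ⊢ HasTy Δ b A ->
    M ⊢ EqTy Γ (tsub (ident A a b) σ) (ident (tsub A σ) (msub a σ) (msub b σ))
| hasty_refl Γ A a :
    M ⊢ IsTy Γ A -> M ⊢ HasTy Γ a A -> M ⊢ HasTy Γ (refl a) (ident A a a)
| hasty_J Γ A C d a b q :
    M ⊢ IsTy Γ A -> M ⊢ IsTy (J_ctx Γ A) C ->
    M ⊢ HasTy (A :: Γ) d (tsub C J_diag) ->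
    M ⊢ HasTy Γ a A -> M ⊢ HasTy Γ b A -> M ⊢ HasTy Γ q (ident A a b) ->
    M ⊢ HasTy Γ (J C d a b q) (tsub C (J_inst a b q))
| eqtm_refl_cong Γ A a a' :
    M ⊢ IsTy Γ A -> M ⊢ EqTm Γ a a' A ->
    M ⊢ EqTm Γ (refl a) (refl a') (ident A a a)
| eqtm_J Γ A C C' d d' a a' b b' q q' :
    M ⊢ IsTy Γ A -> M ⊢ EqTy (J_ctx Γ A) C C' ->
    M ⊢ EqTm (A :: Γ) d d' (tsub C J_diag) ->
    M ⊢ EqTm Γ a a' A -> M ⊢ EqTm Γ b b' A -> M ⊢ EqTm Γ q q' (ident A a b) ->
    M ⊢ EqTm Γ (J C d a b q) (J C' d' a' b' q') (tsub C (J_inst a b q))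
| eqtm_refl_sub Γ Δ σ A a :
    M ⊢ IsSub Γ σ Δ -> M ⊢ IsTy Δ A -> M ⊢ HasTy Δ a A ->
    M ⊢ EqTm Γ (msub (refl a) σ) (refl (msub a σ)) (tsub (ident A a a) σ)
| eqtm_J_sub Γ Δ σ A C d a b q :
    M ⊢ IsSub Γ σ Δ -> M ⊢ IsTy Δ A -> M ⊢ IsTy (J_ctx Δ A) C ->
    M ⊢ HasTy (A :: Δ) d (tsub C J_diag) ->
    M ⊢ HasTy Δ a A -> M ⊢ HasTy Δ b A -> M ⊢ HasTy Δ q (ident A a b) ->
    M ⊢ EqTm Γ (msub (J C d a b q) σ)
          (J (tsub C (up (up (up σ)))) (msub d (up σ))
             (msub a σ) (msub b σ) (msub q σ))
          (tsub (tsub C (J_inst a b q)) σ)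
| eqtm_J_beta Γ A C d a :
    M ⊢ IsTy Γ A -> M ⊢ IsTy (J_ctx Γ A) C ->
    M ⊢ HasTy (A :: Γ) d (tsub C J_diag) -> M ⊢ HasTy Γ a A ->
    M ⊢ EqTm Γ (J C d a a (refl a)) (msub d (inst a))
               (tsub C (J_inst a a (refl a)))

where "M ⊢ j" := (@derivable M j).

(** * The syntactic category *)

(* Objects are contexts; morphisms are substitutions up to judgmental equality,
   an equivalence class being represented by its characteristic predicate. *)
Section Syntactic.
Context (M : theory).

Definition syn_ob := {Γ : ctx M | M ⊢ WfCtx Γ}.

Definition syn_hom (Γ Δ : syn_ob) :=
  {P : sub M -> Prop | exists σ, M ⊢ IsSub (proj1_sig Γ) σ (proj1_sig Δ) /\
     forall τ, P τ <-> M ⊢ EqSub (proj1_sig Γ) σ τ (proj1_sig Δ)}.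

Definition syn_class {Γ Δ : syn_ob} (σ : sub M)
    (Hσ : M ⊢ IsSub (proj1_sig Γ) σ (proj1_sig Δ)) : syn_hom Γ Δ :=
  exist _ (fun τ => M ⊢ EqSub (proj1_sig Γ) σ τ (proj1_sig Δ))
    (ex_intro _ σ (conj Hσ (fun τ => iff_refl _))).

Definition syn_comp_pred {Γ Δ Θ : syn_ob} (Q : syn_hom Δ Θ) (P : syn_hom Γ Δ)
    (ρ : sub M) : Prop :=
  exists τ σ, proj1_sig Q τ /\ proj1_sig P σ /\
    M ⊢ EqSub (proj1_sig Γ) (scomp τ σ) ρ (proj1_sig Θ).

Lemma syn_comp_class (Γ Δ Θ : syn_ob) (Q : syn_hom Δ Θ) (P : syn_hom Γ Δ) :
  exists σ, M ⊢ IsSub (proj1_sig Γ) σ (proj1_sig Θ) /\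
    forall ρ, syn_comp_pred Q P ρ <->
              M ⊢ EqSub (proj1_sig Γ) σ ρ (proj1_sig Θ).
Proof.
  destruct Q as [Q [τ [Hτ EQ]]], P as [P [σ [Hσ EP]]].
  exists (scomp τ σ). split; [exact (issub_comp Hσ Hτ)|].
  intro ρ; unfold syn_comp_pred; simpl; split.
  - intros (τ' & σ' & HQ & HP & H). apply EQ in HQ. apply EP in HP.
    exact (eqsub_trans (eqsub_comp HP HQ) H).
  - intro H. exists τ, σ. rewrite EQ, EP. auto using eqsub_refl.
Qed.

Definition syn_comp {Γ Δ Θ : syn_ob} (Q : syn_hom Δ Θ) (P : syn_hom Γ Δ) :
    syn_hom Γ Θ :=
  exist _ (syn_comp_pred Q P) (syn_comp_class Q P).

Lemma syn_hom_eq (Γ Δ : syn_ob) (P Q : syn_hom Γ Δ) :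
  (forall σ, proj1_sig P σ <-> proj1_sig Q σ) -> P = Q.
Proof.
  destruct P as [P HP], Q as [Q HQ]; simpl; intro H.
  assert (E : P = Q)
    by (apply functional_extensionality; intro; apply propositional_extensionality, H).
  subst. f_equal. apply proof_irrelevance.
Qed.

Lemma syn_class_eq (Γ Δ : syn_ob) (σ τ : sub M)
    (Hσ : M ⊢ IsSub (proj1_sig Γ) σ (proj1_sig Δ))
    (Hτ : M ⊢ IsSub (proj1_sig Γ) τ (proj1_sig Δ)) :
  M ⊢ EqSub (proj1_sig Γ) σ τ (proj1_sig Δ) -> syn_class Hσ = syn_class Hτ.
Proof.
  intro H. apply syn_hom_eq; intro ρ; simpl.
  split; eauto using eqsub_trans, eqsub_sym.
Qed.

Lemma syn_class_surj (Γ Δ : syn_ob) (P : syn_hom Γ Δ) :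
  exists σ (Hσ : M ⊢ IsSub (proj1_sig Γ) σ (proj1_sig Δ)), P = syn_class Hσ.
Proof.
  destruct (proj2_sig P) as [σ [Hσ H]]. exists σ, Hσ.
  apply syn_hom_eq; intro τ. apply H.
Qed.

Lemma syn_comp_classE (Γ Δ Θ : syn_ob) (σ τ : sub M)
    (Hτ : M ⊢ IsSub (proj1_sig Δ) τ (proj1_sig Θ))
    (Hσ : M ⊢ IsSub (proj1_sig Γ) σ (proj1_sig Δ)) :
  syn_comp (syn_class Hτ) (syn_class Hσ) = syn_class (issub_comp Hσ Hτ).
Proof.
  apply syn_hom_eq; intro ρ; simpl; unfold syn_comp_pred; simpl; split.
  - intros (τ' & σ' & HQ & HP & H). exact (eqsub_trans (eqsub_comp HP HQ) H).
  - intro H. exists τ, σ. auto using eqsub_refl.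
Qed.

Definition syn_cat : category.
Proof.
  refine (@Category syn_ob syn_hom
    (fun Γ => syn_class (issub_id (proj2_sig Γ))) (@syn_comp) _ _ _).
  - intros Γ Δ P. destruct (syn_class_surj P) as (σ & Hσ & ->).
    rewrite syn_comp_classE. apply syn_class_eq, eqsub_idl, Hσ.
  - intros Γ Δ P. destruct (syn_class_surj P) as (σ & Hσ & ->).
    rewrite syn_comp_classE. apply syn_class_eq, eqsub_idr, Hσ.
  - intros Γ Δ Θ Ξ R Q P. destruct (syn_class_surj P) as (σ & Hσ & ->).
    destruct (syn_class_surj Q) as (τ & Hτ & ->).
    destruct (syn_class_surj R) as (ρ & Hρ & ->).
    rewrite !syn_comp_classE. apply syn_class_eq.
    exact (eqsub_assoc Hσ Hτ Hρ).
Defined.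

Definition type_in (Γ : syn_ob) := {A : ty M | M ⊢ IsTy (proj1_sig Γ) A}.

Definition term_of {Γ : syn_ob} (A : type_in Γ) :=
  {a : tm M | M ⊢ HasTy (proj1_sig Γ) a (proj1_sig A)}.

Definition ext {Γ : syn_cat} (A : type_in Γ) : syn_cat :=
  exist _ (proj1_sig A :: proj1_sig Γ) (wf_cons (proj2_sig Γ) (proj2_sig A)).

Definition proj {Γ : syn_cat} (A : type_in Γ) : hom (ext A) Γ :=
  syn_class (Γ := ext A) (issub_wk (proj2_sig Γ) (proj2_sig A)).

Lemma eqctx_refl (Γ : ctx M) : M ⊢ WfCtx Γ -> M ⊢ EqCtx Γ Γ.
Proof.
  induction Γ as [|A Γ IH]; intro H; [constructor|].
  inversion H; subst. constructor; auto using eqty_refl.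
Qed.

Lemma term_section_proof (Γ : syn_cat) (A : type_in Γ) (a : term_of A) :
  M ⊢ IsSub (proj1_sig Γ) (inst (proj1_sig a)) (proj1_sig (ext A)).
Proof.
  destruct Γ as [Γ HΓ], A as [A HA], a as [a Ha]; simpl in *.
  apply issub_ext; [now apply issub_id|assumption|].
  exact (hasty_conv (eqctx_refl HΓ) (eqty_sym (eqty_sub_id HA)) Ha).
Qed.

Definition term_section {Γ : syn_cat} {A : type_in Γ} (a : term_of A) :
    hom Γ (ext A) :=
  syn_class (term_section_proof a).

(* Up to isomorphism, the projections from iterated context extensions. *)
Inductive syn_fib : forall Γ Δ : syn_cat, hom Γ Δ -> Prop :=
| syn_fib_iso Γ Δ (f : hom Γ Δ) : is_iso f -> syn_fib f
| syn_fib_proj Γ (A : type_in Γ) : syn_fib (proj A)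
| syn_fib_comp Γ Δ Θ (g : hom Δ Θ) (f : hom Γ Δ) :
    syn_fib g -> syn_fib f -> syn_fib (g ∘ f).

Definition syn : fib_category := @FibCategory syn_cat (@syn_fib).
End Syntactic.

Arguments term_section {M Γ A} a.

Definition interpretation (M : theory) (C : fib_category)
    (F : functor (syn M) C) : Prop :=
  type_theoretic F.

Record logical_predicate {M : theory} {E B : fib_category} (p : functor E B)
    (F : functor (syn M) B) (R : functor (syn M) E) : Prop := LogicalPredicate {
  lp_interpretation : interpretation R;
  lp_over : functor_comp p R = F
}.

(* RΓ as an object of the fiber over FΓ. *)
Definition pred_ob {M : theory} {E B : fib_category} {p : functor E B}
    {F : functor (syn M) B} {R : functor (syn M) E}
    (HR : logical_predicate p F R) (Γ : syn M) : fiber p (F Γ) :=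
  exist _ (R Γ) (f_equal (fun G : functor (syn M) B => G Γ) (lp_over HR)).

(* Main.v *)
Require Import Defs.

Set Implicit Arguments.
Unset Strict Implicit.
Unset Printing Implicit Defensive.

Local Open Scope cat_scope.

(** The term [t_hat] is the factorization of [R t] through the cartesian lift
  [Q -> R(A.T)] of [F t], and it is a section because [R π_T ∘ R t] is the
  identity.  That its codomain is a type over [RA] comes from two facts: a
  square whose horizontal sides are cartesian over the same morphism is a
  pullback, so [v = t^*u] is a fibration as soon as [u] is; and a cartesian
  morphism over an identity is invertible. *)

Lemma hom_eq_sym (C : category) (X Y X' Y' : C)
    (f : hom X Y) (f' : hom X' Y') :
  hom_eq f f' -> hom_eq f' f.
Proof. now intros []. Qed.

Lemma hom_eq_trans (C : category) (X Y X' Y' X'' Y'' : C)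
    (f : hom X Y) (f' : hom X' Y') (f'' : hom X'' Y'') :
  hom_eq f f' -> hom_eq f' f'' -> hom_eq f f''.
Proof. intros H []. exact H. Qed.

Section Cartesian.
Context {E B : category} (p : functor E B).

Lemma above_comp (X Y Z : E) (g : hom Y Z) (f : hom X Y)
    (I J K : B) (t : hom J K) (s : hom I J) :
  above p f s -> above p g t -> above p (g ∘ f) (t ∘ s).
Proof.
  intros Hf Hg. unfold above. rewrite fmap_comp. now apply hom_eq_comp.
Qed.

Lemma above_idm (X : E) (I : B) : p X = I -> above p (idm X) (idm I).
Proof. intros <-. unfold above. rewrite fmap_id. constructor. Qed.

Lemma above_codomain (W X : E) (f : hom W X) (I : B) :
  p X = I -> exists w : hom (p W) I, above p f w.
Proof. intros <-. exists (fmap p f). constructor. Qed.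

(** This is the existence half of [cartesian], for base morphisms whose endpoints are only
    propositionally equal to images under [p], as happens for objects of fibers. Destructing the
    [above] hypotheses identifies those endpoints. *)
Lemma cartesian_lift (X Y Z : E) (f : hom X Y) (g : hom Z Y)
    (I J K : B) (s : hom I J) (w : hom K I) :
  cartesian p f -> above p f s -> above p g (s ∘ w) ->
  exists h : hom Z X, above p h w /\ f ∘ h = g.
Proof.
  intros Hc Hf Hg. destruct Hf. unfold above in Hg.
  assert (e : p Z = K) by now destruct Hg.
  subst K. apply hom_eq_eq in Hg.
  destruct (Hc Z g w Hg) as (h & [Hw Hh] & _).
  exists h. split; [|exact Hh]. unfold above. rewrite Hw. constructor.
Qed.

(** The uniqueness half of [cartesian]: both maps factor [f ∘ h] over the same base morphism. *)
Lemma cartesian_cancel (X Y Z : E) (f : hom X Y) (h h' : hom Z X)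
    (K I : B) (w : hom K I) :
  cartesian p f -> above p h w -> above p h' w -> f ∘ h = f ∘ h' -> h = h'.
Proof.
  intros Hc Hh Hh' e.
  assert (ew : fmap p h' = fmap p h)
    by exact (hom_eq_eq (hom_eq_trans Hh' (hom_eq_sym Hh))).
  destruct (Hc Z (f ∘ h) (fmap p h) (fmap_comp p f h)) as (k & _ & Hk).
  transitivity k; [symmetry|]; apply Hk; auto.
Qed.

Lemma cartesian_comp (X Y Z : E) (g : hom Y Z) (f : hom X Y) :
  cartesian p g -> cartesian p f -> cartesian p (g ∘ f).
Proof.
  intros Hg Hf W k w e. rewrite fmap_comp, <- comp_assoc in e.
  destruct (Hg W k _ e) as (l & [Hl1 Hl2] & Hl).
  destruct (Hf W l w Hl1) as (m & [Hm1 Hm2] & Hm).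
  exists m. split.
  - split; [exact Hm1|]. now rewrite <- comp_assoc, Hm2.
  - intros m' [H1 H2]. apply Hm. split; [exact H1|]. symmetry. apply Hl.
    split; [now rewrite fmap_comp, H1|]. now rewrite comp_assoc.
Qed.

(** Lifting the identity of [Y] through [f] gives a right inverse; cancelling [f] shows that it is
    also a left inverse. *)
Lemma fiber_cartesian_iso (I : B) (X Y : fiber_cat p I) (f : hom X Y) :
  cartesian p (proj1_sig f) -> is_iso f.
Proof.
  intro Hc.
  destruct (@cartesian_lift _ _ _ _ (idm (proj1_sig Y)) I I I (idm I) (idm I)
              Hc (proj2_sig f)) as (g & Hg & e).
  { rewrite comp_idl. exact (above_idm (proj2_sig Y)). }
  exists (exist _ g Hg). split; apply fiber_hom_eq; simpl; [|exact e].
  apply (@cartesian_cancel _ _ _ _ _ _ I I (idm I) Hc).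
  - rewrite <- (comp_idl (idm I)). exact (above_comp (proj2_sig f) Hg).
  - exact (above_idm (proj2_sig X)).
  - now rewrite comp_assoc, e, comp_idl, comp_idr.
Qed.

Lemma fiber_iso_total (I : B) (X Y : fiber_cat p I) (f : hom X Y) :
  is_iso f -> is_iso (proj1_sig f).
Proof.
  intros (g & H1 & H2). exists (proj1_sig g). split.
  - exact (f_equal (@proj1_sig _ _) H1).
  - exact (f_equal (@proj1_sig _ _) H2).
Qed.

(** Let a cone [(a, b)] have [b] above [w]. As [u] is vertical, [a] lies above [s ∘ w], so it
    factors through [kX] by some [k] above [w]; cancelling [kY] gives [v ∘ k = b]. *)
Lemma cartesian_square_pullback (I J : B) (s : hom I J)
    (X Y : fiber_cat p J) (X' Y' : fiber_cat p I)
    (u : hom X Y) (v : hom X' Y')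
    (kX : hom (proj1_sig X') (proj1_sig X))
    (kY : hom (proj1_sig Y') (proj1_sig Y)) :
  above p kX s -> cartesian p kX -> above p kY s -> cartesian p kY ->
  kY ∘ proj1_sig v = proj1_sig u ∘ kX ->
  is_pullback (proj1_sig u) kY kX (proj1_sig v).
Proof.
  intros aX cX aY cY sq. split; [now symmetry|].
  intros W a b e.
  destruct (above_codomain b (proj2_sig Y')) as (w & Hb).
  assert (v_above : forall k : hom W (proj1_sig X'), above p k w -> above p (proj1_sig v ∘ k) w).
  { intros k Hk. rewrite <- (comp_idl w). exact (above_comp Hk (proj2_sig v)). }
  assert (Ha : above p a (s ∘ w)).
  { destruct (above_codomain a (proj2_sig X)) as (w' & Ha).
    pose proof (above_comp Ha (proj2_sig u)) as H1.
    pose proof (above_comp Hb aY) as H2.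
    rewrite comp_idl in H1. rewrite e in H1.
    exact (hom_eq_trans Ha (hom_eq_trans (hom_eq_sym H1) H2)). }
  destruct (cartesian_lift cX aX Ha) as (k & Hk & ek).
  exists k. split.
  - split; [exact ek|].
    apply (cartesian_cancel cY (v_above k Hk) Hb).
    now rewrite comp_assoc, sq, <- comp_assoc, ek.
  (* Since [v] is vertical and [v ∘ k' = b], the competitor [k'] also lies above [w]. *)
  - intros k' [e1 e2]. apply (@cartesian_cancel _ _ _ _ _ _ _ _ w cX Hk).
    + destruct (above_codomain k' (proj2_sig X')) as (w' & Hk').
      pose proof (above_comp Hk' (proj2_sig v)) as H.
      rewrite comp_idl, e2 in H.
      exact (hom_eq_trans Hk' (hom_eq_trans (hom_eq_sym H) Hb)).
    + now rewrite ek, e1.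
Qed.
End Cartesian.

(** Axiom (3) for the factorization of [p g] as itself after an identity, which is a fibration
    because it is an isomorphism. *)
Lemma fibred_fib_induced (E B : fib_category) (p : functor E B)
    (X Y Z : E) (g : hom X Z) (k : hom Y Z) (h : hom X Y)
    (I J : B) (t : hom I J) :
  fibred_ttfc p -> fib g -> above p g t -> above p k t -> cartesian p k ->
  above p h (idm I) -> k ∘ h = g -> fib h.
Proof.
  intros Hp Hg ag ak ck ah e. destruct ag.
  refine (fibred_induced_fib Hp Hg _ _ ak ck ah e).
  - now rewrite comp_idr.
  - apply (fib_iso (fibred_base Hp)). exists (idm _).
    split; apply comp_idl.
Qed.

Lemma proj_term_section (M : theory) (A : syn M) (T : type_in A)
    (t : term_of T) :
  proj T ∘ term_section t = idm A.
Proof.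
  destruct A as [Γ HΓ], T as [T HT], t as [t Ht].
  refine (eq_trans (syn_comp_classE _ _) _). apply syn_class_eq; simpl in *.
  apply eqsub_wk with (A := T); [now apply issub_id|assumption|].
  (* The rule expects [t] in [T[sid]], so its type is converted. *)
  exact (hasty_conv (eqctx_refl HΓ) (eqty_sym (eqty_sub_id HT)) Ht).
Qed.

Lemma fib_proj_fmap (M : theory) (C : fib_category) (R : functor (syn M) C)
    (A : syn M) (T : type_in A) :
  interpretation R -> fib (fmap R (proj T)).
Proof. intro HR. apply (tt_fib HR). exact (@syn_fib_proj M A T). Qed.

(** Eliminating [lp_over] replaces [F] by the composite of [p] and [R], after which both sides agree
    by computation. *)
Lemma above_fmap_predicate (M : theory) (E B : fib_category) (p : functor E B)
    (F : functor (syn M) B) (R : functor (syn M) E)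
    (HR : logical_predicate p F R) (Γ Δ : syn M) (f : hom Γ Δ) :
  above p (fmap R f) (fmap F f).
Proof. destruct HR as [_ <-]. constructor. Qed.

(* For a type T over A and a term t of T: P is the reindexing of RA along F π_T,
   Q and Q' those of R(A.T) and P along F t.  The maps u : R(A.T) -> P, v = t^*u
   and φ : Q' ≅ RA compose to the type r : RA ⊢ RT(a, Ft(a); r), that is to
   φ ∘ v : Q -> RA. *)
Theorem mainTheorem10 (E B : fib_category) (p : functor E B)
    (Hp : fibred_ttfc p)
    (M : theory) (F : functor (syn M) B) (HF : interpretation F)
    (R : functor (syn M) E) (HR : logical_predicate p F R)
    (A : syn M) (T : type_in A) (t : term_of T)
    (P : reindexing (fmap F (proj T)) (pred_ob HR A))
    (Q : reindexing (fmap F (term_section t)) (pred_ob HR (ext T)))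
    (Q' : reindexing (fmap F (term_section t)) (P : fiber p (F (ext T)))) :
  exists (u : hom (pred_ob HR (ext T)) (P : fiber p (F (ext T))))
         (v : hom (Q : fiber p (F A)) (Q' : fiber p (F A)))
         (φ : hom (Q' : fiber p (F A)) (pred_ob HR A)),
    lift P ∘ proj1_sig u = fmap R (proj T) /\
    is_type u /\
    is_reindexing_of u v /\
    proj1_sig φ = lift P ∘ lift Q' /\
    is_iso φ /\
    is_type (φ ∘ v) /\
    exists t_hat : hom (pred_ob HR A) (Q : fiber p (F A)),
      lift Q ∘ proj1_sig t_hat = fmap R (term_section t) /\
      is_term (φ ∘ v) t_hat.
Proof.
  set (π := proj T) in *. set (τ := term_section t) in *.
  assert (aR : forall Γ Δ (f : hom Γ Δ), above p (fmap R f) (fmap F f))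
    by exact (above_fmap_predicate HR).
  assert (sec : π ∘ τ = idm A) by apply proj_term_section.
  assert (fib_π : fib (fmap R π)) by exact (fib_proj_fmap T (lp_interpretation HR)).
  destruct (@cartesian_lift _ _ p _ _ _ _ (fmap R π) _ _ _ _ (idm (F (ext T)))
              (lift_cartesian (r := P)) (lift_above P)) as (u & au & eu).
  { rewrite comp_idr. apply aR. }
  assert (fib_u : fib u)
    by exact (fibred_fib_induced Hp fib_π (aR _ _ π) (lift_above P)
                (lift_cartesian (r := P)) au eu).
  destruct (@cartesian_lift _ _ p _ _ _ _ (u ∘ lift Q) _ _ _ _ (idm (F A))
              (lift_cartesian (r := Q')) (lift_above Q')) as (v & av & ev).
  { rewrite comp_idr, <- (comp_idl (fmap F τ)).
    exact (above_comp (lift_above Q) au). }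
  (* The composite lies above [F π ∘ F τ = F (π ∘ τ)], an identity because [τ] is a section of
     [π]. *)
  assert (aφ : above p (lift P ∘ lift Q') (idm (F A))).
  { rewrite <- fmap_id, <- sec, fmap_comp.
    exact (above_comp (lift_above Q') (lift_above P)). }
  pose (U := exist _ u au : hom (pred_ob HR (ext T)) (P : fiber p (F (ext T)))).
  pose (V := exist _ v av : hom (Q : fiber p (F A)) (Q' : fiber p (F A))).
  pose (φ := exist _ (lift P ∘ lift Q') aφ
             : hom (Q' : fiber p (F A)) (pred_ob HR A)).
  assert (iso_φ : is_iso φ).
  { apply (@fiber_cartesian_iso E B p (F A) _ _ φ).
    exact (cartesian_comp (lift_cartesian (r := P)) (lift_cartesian (r := Q'))). }
  exists U, V, φ. split; [exact eu|]. split; [exact fib_u|].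
  split; [exact ev|]. split; [reflexivity|]. split; [exact iso_φ|]. split.
  { apply (fib_comp (fibred_total Hp) (g := proj1_sig φ) (f := v)).
    - apply (fib_iso (fibred_total Hp)).
      exact (@fiber_iso_total E B p (F A) _ _ φ iso_φ).
    - refine (pullback_fib (fibred_total Hp) fib_u (p1 := lift Q) (g := lift Q') _).
      exact (@cartesian_square_pullback E B p _ _ (fmap F τ) _ _ _ _ U V _ _
               (lift_above Q) (lift_cartesian (r := Q))
               (lift_above Q') (lift_cartesian (r := Q')) ev). }
  destruct (@cartesian_lift _ _ p _ _ _ _ (fmap R τ) _ _ _ _ (idm (F A))
              (lift_cartesian (r := Q)) (lift_above Q)) as (r & ar & er).
  { rewrite comp_idr. apply aR. }
  exists (exist _ r ar : hom (pred_ob HR A) (Q : fiber p (F A))).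
  split; [exact er|].
  apply fiber_hom_eq.
  change (lift P ∘ lift Q' ∘ v ∘ r = idm (R A)).
  (* Sliding [v] across the reindexing square [ev] exposes the factorizations [eu] of [R π] and [er]
     of [R τ]. *)
  transitivity (lift P ∘ u ∘ (lift Q ∘ r)).
  - rewrite <- (comp_assoc (lift P)), ev. now rewrite !comp_assoc.
  - transitivity (fmap R π ∘ fmap R τ); [exact (f_equal2 comp eu er)|].
    rewrite <- fmap_comp. exact (eq_trans (f_equal (fmap R) sec) (fmap_id R A)).
Qed.
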